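(* Let $\mathscr{X}=(P,\Theta_P)$ be a div point set with $|P|=4$ that satisfies the three laws (L1), (L2), (L3) below. Then $\mathscr{X}$ is not isomorphic to $Conc_4^1$ if and only if $\mathscr{X}$ is isomorphic to $Conv_4$.
   Context: A div point set is an ordered pair $(P,\Theta_P)$ where $P$ is a nonempty finite set and $\Theta_P$ is a set with $|\Theta_P|=\binom{|P|}{2}$ such that: every $D\in\Theta_P$ is an ordered pair $D=(d,\delta)$ with $d\subseteq P$, $|d|=2$, and $\delta$ a set with exactly two elements (each a subset of $P$) satisfying $\bigcup\delta=P\setminus d$ and $\bigcap\delta=\varnothing$; and two elements of $\Theta_P$ are equal iff their first components are equal. We write $\pi_1(D)=d$, $\pi_2(D)=\delta$ (elements of $\Theta_P$ are called dividons). For a set $\delta$ of sets and a 2-element set $T\subseteq\bigcup\delta$, let $\phi(\delta,T)=1$ if some element of $\delta$ contains $T$, and $\phi(\delta,T)=0$ if every element of $\delta$ meets $T$ in at most one point. Laws (for every 4-element subset $R\subseteq P$ and all $D_1,D_2,D_3\in\Theta_P$, writing $\phi_i=\phi(\pi_2(D_i),R\setminus\pi_1(D_i))$): (L1) if $\pi_1(D_1)\cup\pi_1(D_2)\cup\pi_1(D_3)=R$ and $|\pi_1(D_1)\cap\pi_1(D_2)\cap\pi_1(D_3)|=1$, then ($\phi_1=0\iff\phi_2=\phi_3$); (L2) under the same hypothesis, ($\phi_1=1\iff\phi_2\neq\phi_3$); (L3) if $D_1,D_2,D_3$ are pairwise distinct, $\pi_1(D_1)\cup\pi_1(D_2)\cup\pi_1(D_3)\subset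 R$ and $|\pi_1(D_1)\cup\pi_1(D_2)\cup\pi_1(D_3)|=3$, then ($\phi_1=\phi_2=0\Rightarrow\phi_3=1$). Two div point sets $(A,\Theta_A)$, $(B,\Theta_B)$ are isomorphic if there is a bijection $f:A\to B$ such that for every $(d,\delta)\in\Theta_A$, the pair $(f[d],\{f[X]:X\in\delta\})$ belongs to $\Theta_B$ (here $f[X]$ is the image of the set $X$). $Conc_4^1=(\{1,2,3,4\},\Theta)$ with $\Theta=\{(\{1,2\},\{\{3\},\{4\}\}),(\{1,3\},\{\{2\},\{4\}\}),(\{1,4\},\{\{2\},\{3\}\}),(\{2,3\},\{\{1,4\},\varnothing\}),(\{2,4\},\{\{1,3\},\varnothing\}),(\{3,4\},\{\{1,2\},\varnothing\})\}$. $Conv_4=(\{1,2,3,4\},\Theta')$ with $\Theta'=\{(\{1,2\},\{\{3,4\},\varnothing\}),(\{1,3\},\{\{2\},\{4\}\}),(\{1,4\},\{\{2,3\},\varnothing\}),(\{2,3\},\{\{1,4\},\varnothing\}),(\{2,4\},\{\{1\},\{3\}\}),(\{3,4\},\{\{1,2\},\varnothing\})\}$. *)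

(* Defs.v *)
From HB Require Import structures.
From mathcomp Require Import all_boot.

Set Implicit Arguments.
Unset Strict Implicit.
Unset Printing Implicit Defensive.

(* The finite point set P is a finType, and its subsets are
   the elements of {set P}. *)

Definition dividon (P : finType) : Type := ({set P} * {set {set P}})%type.

Definition is_dividon (P : finType) (D : dividon P) : Prop :=
  [/\ #|D.1| = 2, #|D.2| = 2,
      \bigcup_(X in D.2) X = [set: P] :\: D.1
    & \bigcap_(X in D.2) X = set0].

Record divPointSet (P : finType) := DivPointSet {
  dividons :> {set dividon P};
  points_nonempty : 0 < #|P|;
  card_dividons : #|dividons| = 'C(#|P|, 2);
  dividonsP : forall D, D \in dividons -> is_dividon D;
  dividons_eq : forall D1 D2, D1 \in dividons -> D2 \in dividons ->
    (D1 = D2 <-> D1.1 = D2.1)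
}.

(* Only meaningful when #|T| = 2 and T is included in the union of delta;
   phi_eq0 shows that on 2-element sets the value 0 has its intended
   meaning. *)
Definition phi (P : finType) (delta : {set {set P}}) (T : {set P}) : nat :=
  if [exists X in delta, T \subset X] then 1 else 0.

Lemma phi_eq0 (P : finType) (delta : {set {set P}}) (T : {set P}) :
  #|T| = 2 ->
  (phi delta T = 0 <-> forall X, X \in delta -> #|X :&: T| <= 1).
Proof.
move=> cT; rewrite /phi; case: exists_inP => [[X Xd TX]|H]; split => //.
  by move/(_ X Xd); rewrite (setIidPr TX) cT.
move=> _ X Xd; rewrite -ltnS -cT; apply: proper_card.
rewrite properE subsetIr /=; apply/negP; rewrite subsetI => /andP[TX _].
by apply: H; exists X.
Qed.

Definition law1 (P : finType) (X : divPointSet P) : Prop :=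
  forall R : {set P}, #|R| = 4 ->
  forall D1 D2 D3, D1 \in dividons X -> D2 \in dividons X ->
  D3 \in dividons X ->
  D1.1 :|: D2.1 :|: D3.1 = R -> #|D1.1 :&: D2.1 :&: D3.1| = 1 ->
  (phi D1.2 (R :\: D1.1) = 0 <->
   phi D2.2 (R :\: D2.1) = phi D3.2 (R :\: D3.1)).

Definition law2 (P : finType) (X : divPointSet P) : Prop :=
  forall R : {set P}, #|R| = 4 ->
  forall D1 D2 D3, D1 \in dividons X -> D2 \in dividons X ->
  D3 \in dividons X ->
  D1.1 :|: D2.1 :|: D3.1 = R -> #|D1.1 :&: D2.1 :&: D3.1| = 1 ->
  (phi D1.2 (R :\: D1.1) = 1 <->
   phi D2.2 (R :\: D2.1) <> phi D3.2 (R :\: D3.1)).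

Definition law3 (P : finType) (X : divPointSet P) : Prop :=
  forall R : {set P}, #|R| = 4 ->
  forall D1 D2 D3, D1 \in dividons X -> D2 \in dividons X ->
  D3 \in dividons X ->
  D1 <> D2 -> D1 <> D3 -> D2 <> D3 ->
  D1.1 :|: D2.1 :|: D3.1 \proper R -> #|D1.1 :|: D2.1 :|: D3.1| = 3 ->
  phi D1.2 (R :\: D1.1) = 0 -> phi D2.2 (R :\: D2.1) = 0 ->
  phi D3.2 (R :\: D3.1) = 1.

Definition isomorphic (A B : finType) (X : divPointSet A) (Y : divPointSet B) :
    Prop :=
  exists2 f : A -> B, bijective f &
    forall D, D \in dividons X ->
      (f @: D.1, [set f @: S | S : {set A} in D.2]) \in dividons Y.

(* The points 1, 2, 3, 4 are the elements of 'I_4, whose underlying values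
   are shifted by one. *)
Definition p1 : 'I_4 := @Ordinal 4 0 isT.
Definition p2 : 'I_4 := @Ordinal 4 1 isT.
Definition p3 : 'I_4 := @Ordinal 4 2 isT.
Definition p4 : 'I_4 := @Ordinal 4 3 isT.

Definition Conc41_dividons : {set dividon 'I_4} :=
  [set ([set p1; p2], [set [set p3]; [set p4]]);
       ([set p1; p3], [set [set p2]; [set p4]]);
       ([set p1; p4], [set [set p2]; [set p3]]);
       ([set p2; p3], [set [set p1; p4]; set0]);
       ([set p2; p4], [set [set p1; p3]; set0]);
       ([set p3; p4], [set [set p1; p2]; set0])].

Definition Conv4_dividons : {set dividon 'I_4} :=
  [set ([set p1; p2], [set [set p3; p4]; set0]);
       ([set p1; p3], [set [set p2]; [set p4]]);
       ([set p1; p4], [set [set p2; p3]; set0]);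
       ([set p2; p3], [set [set p1; p4]; set0]);
       ([set p2; p4], [set [set p1]; [set p3]]);
       ([set p3; p4], [set [set p1; p2]; set0])].

Lemma is_dividon_set2 (P : finType) (d A B : {set P}) :
  #|d| = 2 -> A != B -> A :|: B = ~: d -> A :&: B = set0 ->
  is_dividon (d, [set A; B]).
Proof.
move=> cd AB U I; split=> //=; first by rewrite cards2 AB.
  by rewrite setTD -U bigcup_setU !big_set1.
by rewrite bigcap_setU !big_set1.
Qed.

Lemma eq_set4 (A B : {set 'I_4}) :
  (A == B) = [&& (p1 \in A) == (p1 \in B), (p2 \in A) == (p2 \in B),
                 (p3 \in A) == (p3 \in B) & (p4 \in A) == (p4 \in B)].
Proof.
apply/eqP/and4P => [-> //|[/eqP H1 /eqP H2 /eqP H3 /eqP H4]].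
apply/setP => -[[|[|[|[|m]]]] Hm] //.
- by rewrite (_ : Ordinal Hm = p1) //; apply: val_inj.
- by rewrite (_ : Ordinal Hm = p2) //; apply: val_inj.
- by rewrite (_ : Ordinal Hm = p3) //; apply: val_inj.
- by rewrite (_ : Ordinal Hm = p4) //; apply: val_inj.
Qed.

Ltac set4_dividon :=
  apply: is_dividon_set2;
    [by rewrite cards2 | by rewrite eq_set4 !inE
    | by apply/eqP; rewrite eq_set4 !inE | by apply/eqP; rewrite eq_set4 !inE].

Ltac set4_card :=
  rewrite ?/Conc41_dividons ?/Conv4_dividons -!setUA !cardsU1 cards1 card_ord
    !inE !xpair_eqE !eq_set4 !inE; by [].

Ltac set4_cases :=
  rewrite ?/Conc41_dividons ?/Conv4_dividons !inE -!orbA;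
  case/or4P => [/eqP->|/eqP->|/eqP->|/or3P[]/eqP->].

Ltac set4_inj :=
  let H := fresh "H" in
  move=> + H; set4_cases; move: H; set4_cases;
  (split; [exact: (congr1 fst) | move=> /= /eqP; rewrite ?eq_set4 ?inE //]).

Lemma Conc41_card : #|Conc41_dividons| = 'C(#|'I_4|, 2).
Proof. by set4_card. Qed.

Lemma Conc41_dividonsP D : D \in Conc41_dividons -> is_dividon D.
Proof. by set4_cases; set4_dividon. Qed.

Lemma Conc41_eq D1 D2 : D1 \in Conc41_dividons -> D2 \in Conc41_dividons ->
  (D1 = D2 <-> D1.1 = D2.1).
Proof. by set4_inj. Qed.

Lemma Conv4_card : #|Conv4_dividons| = 'C(#|'I_4|, 2).
Proof. by set4_card. Qed.

Lemma Conv4_dividonsP D : D \in Conv4_dividons -> is_dividon D.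
Proof. by set4_cases; set4_dividon. Qed.

Lemma Conv4_eq D1 D2 : D1 \in Conv4_dividons -> D2 \in Conv4_dividons ->
  (D1 = D2 <-> D1.1 = D2.1).
Proof. by set4_inj. Qed.

Lemma I4_nonempty : 0 < #|'I_4|.
Proof. by rewrite card_ord. Qed.

Definition Conc41 : divPointSet 'I_4 :=
  DivPointSet I4_nonempty Conc41_card Conc41_dividonsP Conc41_eq.

Definition Conv4 : divPointSet 'I_4 :=
  DivPointSet I4_nonempty Conv4_card Conv4_dividonsP Conv4_eq.

(* Main.v *)
From Corelib Require Import Setoid.
Require Import Defs.
From mathcomp Require Import all_boot.

(** Colour an edge [{x, y}] of the complete graph on [P] by whether the dividon
of [{x, y}] has an empty side.  On four points this colouring determines the div
point set.  The first two laws say that every vertex meets an even number of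
coloured edges, the third one that every triangle has a coloured edge.  The
nonempty even subgraphs of K4 are the four triangles (Conc41) and the three
4-cycles (Conv4). *)

Set Implicit Arguments.
Unset Strict Implicit.
Unset Printing Implicit Defensive.

(** * The edge colouring and the dividons it determines *)

Definition one_sided (P : finType) (X : divPointSet P) (d : {set P}) : bool :=
  [exists D in dividons X, (D.1 == d) && (set0 \in D.2)].

(** When [T] is a pair, these are its only divisions into two disjoint sides: all against nothing,
    or point against point. *)
Definition split_sides (P : finType) (b : bool) (T : {set P}) : {set {set P}} :=
  if b then [set T; set0] else [set [set x] | x in T].

Lemma one_sidedE (P : finType) (X : divPointSet P) D :
  D \in dividons X -> one_sided X D.1 = (set0 \in D.2).
Proof.
move=> XD; apply/exists_inP/idP => [[D' XD' /andP[/eqP eqD]]|D0].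
  by have /(dividons_eq XD' XD) -> := eqD.
by exists D; rewrite ?eqxx.
Qed.

Lemma is_dividonP (P : finType) (D : dividon P) : is_dividon D ->
  exists A B, [/\ D.2 = [set A; B], A :|: B = ~: D.1 & A :&: B = set0].
Proof.
case=> _ /eqP/cards2P[A [B [_ ->]]].
rewrite setTD bigcup_setU bigcap_setU !big_set1 => AUB AIB.
by exists A, B.
Qed.

(** The two sides are disjoint and share the two points off the edge, so their sizes are 2 and 0 or
    1 and 1; the empty set tells the two cases apart. *)
Lemma dividon_sidesE (P : finType) (D : dividon P) : #|P| = 4 ->
  is_dividon D -> D.2 = split_sides (set0 \in D.2) (~: D.1).
Proof.
move=> cardP divD; have [cD1 _ _ _] := divD.
have [A [B [-> AUB AIB]]] := is_dividonP divD.
have cAB : #|A| + #|B| = 2.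
  have := cardsUI A B; rewrite AUB AIB cards0 addn0 => <-.
  by rewrite cardsCs setCK cD1 cardP.
rewrite /split_sides !inE -AUB eq_sym [set0 == B]eq_sym.
have [->|A0] := eqVneq A set0; first by rewrite set0U setUC.
have [->|B0] /= := eqVneq B set0; first by rewrite setU0.
(* Both sizes are now positive with sum 2, so both sides are singletons. *)
move: A0 B0 cAB; rewrite -!card_gt0.
case cA: #|A| => [|[|m]] // _; case cB: #|B| => [|[|n]] // _;
  try by rewrite /= ?addnS.
have /cards1P[a ->] : #|A| == 1 by rewrite cA.
have /cards1P[b ->] : #|B| == 1 by rewrite cB.
by rewrite imsetU1 imset_set1.
Qed.

(** A counting argument: the first projection is injective on dividons, and there are as many
    dividons as pairs of points, so it reaches every pair. *)
Lemma dividon_exists (P : finType) (X : divPointSet P) (d : {set P}) :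
  #|d| = 2 -> exists2 D, D \in dividons X & D.1 = d.
Proof.
move=> cd.
have : [set D.1 | D in dividons X] ==
    [set d : {set P} | d \subset [set: P] & #|d| == 2].
  rewrite eqEcard cards_draws cardsT -(card_dividons X) card_in_imset.
    rewrite leqnn andbT; apply/subsetP => _ /imsetP[D XD ->].
    by rewrite inE subsetT; case: (dividonsP XD) => ->.
  by move=> D1 D2 X1 X2; case: (dividons_eq X1 X2) => _; apply.
move/eqP/setP/(_ d); rewrite inE subsetT cd eqxx => /imsetP[D XD ->].
by exists D.
Qed.

Lemma mem_dividons (P : finType) (X : divPointSet P) (D : dividon P) :
  #|P| = 4 -> #|D.1| = 2 ->
  D.2 = split_sides (one_sided X D.1) (~: D.1) -> D \in dividons X.
Proof.
move=> cardP cD; have [D' XD' eqD] := dividon_exists X cD.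
case: D eqD {cD} => d s /= <-; rewrite one_sidedE // => ->.
by rewrite -dividon_sidesE -?surjective_pairing //; apply: dividonsP XD'.
Qed.

(** The set off the edge has two points, so a singleton side cannot contain it, while an undivided
    side equals it. The laws thus become statements about colours. *)
Lemma phi_one_sided (P : finType) (X : divPointSet P) D :
  #|P| = 4 -> D \in dividons X ->
  phi D.2 ([set: P] :\: D.1) = one_sided X D.1.
Proof.
move=> cardP XD; have divD := dividonsP XD; have [cD1 _ _ _] := divD.
rewrite /phi one_sidedE // {1}dividon_sidesE // setTD.
have cT : #|~: D.1| = 2 by rewrite cardsCs setCK cD1 cardP.
case: (set0 \in D.2); case: exists_inP => //= H; exfalso.
  by apply: H; exists (~: D.1); rewrite ?set21.
by case: H => _ /imsetP[x _ ->] /subset_leq_card; rewrite cT cards1.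
Qed.

(** * The laws as conditions on the colouring *)

Lemma mem_uniq_card (T : finType) (s : seq T) :
  uniq s -> size s = #|T| -> forall x, x \in s.
Proof.
move=> Us cs x; have /subset_cardP sP : #|s| = #|T| by rewrite (card_uniqP Us).
by rewrite (sP _) //; apply/subsetP.
Qed.

(** The three edges at [a] cover all points and meet only in [a], as the first two laws require;
    those laws then fix the parity of the coloured edges. *)
Lemma even_star (P : finType) (X : divPointSet P) (a b c d : P) :
  #|P| = 4 -> law1 X -> law2 X -> uniq [:: a; b; c; d] ->
  one_sided X [set a; b] (+) one_sided X [set a; c] (+) one_sided X [set a; d]
  = false.
Proof.
move=> cardP L1 L2 Uabcd.
have full x : x \in [:: a; b; c; d] by apply: mem_uniq_card.
have ne : [/\ a != b, a != c, a != d, b != c & (b != d) && (c != d)].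
  move: Uabcd; rewrite /= !inE !negb_or => /and4P[/and3P[-> -> ->]].
  by case/andP=> -> -> -> _.
case: ne => ab ac ad bc /andP[bd cd].
have [Db XDb eb] : exists2 D, D \in dividons X & D.1 = [set a; b].
  by apply: dividon_exists; rewrite cards2 ab.
have [Dc XDc ec] : exists2 D, D \in dividons X & D.1 = [set a; c].
  by apply: dividon_exists; rewrite cards2 ac.
have [Dd XDd ed] : exists2 D, D \in dividons X & D.1 = [set a; d].
  by apply: dividon_exists; rewrite cards2 ad.
have U : Db.1 :|: Dc.1 :|: Dd.1 = [set: P].
  apply/setP=> x; rewrite eb ec ed !inE; have := full x; rewrite !inE.
  by case/or4P=> ->; rewrite ?orbT.
have I : #|Db.1 :&: Dc.1 :&: Dd.1| = 1.
  rewrite -(cards1 a) eb ec ed; congr #|pred_of_set _|.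
  apply/setP=> x; rewrite !inE; have [//|_ /=] := eqVneq x a.
  by have [->|//] := eqVneq x b; rewrite (negPf bc).
have cR : #|[set: P]| = 4 by rewrite cardsT.
have := L1 _ cR _ _ _ XDb XDc XDd U I.
have := L2 _ cR _ _ _ XDb XDc XDd U I.
rewrite (phi_one_sided cardP XDb) (phi_one_sided cardP XDc).
rewrite (phi_one_sided cardP XDd) eb ec ed.
(* Among the odd colourings, [law2] refutes those where the edge [ab] is coloured and [law1] the
   others. *)
case: (one_sided X [set a; b]); case: (one_sided X [set a; c]);
  case: (one_sided X [set a; d]) => //= -[h1 h2] [h3 h4] //; exfalso.
all: by [have := h1 erefl; apply | have := h3 erefl | have := h4 erefl].
Qed.

Lemma one_sided_triangle (P : finType) (X : divPointSet P) (a b c : P) :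
  #|P| = 4 -> law3 X -> uniq [:: a; b; c] ->
  [|| one_sided X [set a; b], one_sided X [set b; c] | one_sided X [set a; c]].
Proof.
move=> cardP L3; rewrite /= !inE negb_or andbT => /andP[/andP[ab ac] bc].
have [D1 XD1 e1] : exists2 D, D \in dividons X & D.1 = [set a; b].
  by apply: dividon_exists; rewrite cards2 ab.
have [D2 XD2 e2] : exists2 D, D \in dividons X & D.1 = [set b; c].
  by apply: dividon_exists; rewrite cards2 bc.
have [D3 XD3 e3] : exists2 D, D \in dividons X & D.1 = [set a; c].
  by apply: dividon_exists; rewrite cards2 ac.
have cR : #|[set: P]| = 4 by rewrite cardsT.
have cU : #|D1.1 :|: D2.1 :|: D3.1| = 3.
  have -> : D1.1 :|: D2.1 :|: D3.1 = a |: [set b; c].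
    apply/setP=> x; rewrite e1 e2 e3 !inE.
    by case: (x == a); case: (x == b); case: (x == c).
  by rewrite cardsU1 cards2 !inE negb_or ab ac bc.
have n12 : D1 <> D2.
  move=> /(congr1 fst)/setP/(_ a); rewrite e1 e2 !inE eqxx.
  by rewrite (negPf ab) (negPf ac).
have n13 : D1 <> D3.
  move=> /(congr1 fst)/setP/(_ b); rewrite e1 e3 !inE eqxx orbT.
  by rewrite eq_sym (negPf ab) (negPf bc).
have n23 : D2 <> D3.
  move=> /(congr1 fst)/setP/(_ a); rewrite e2 e3 !inE eqxx.
  by rewrite (negPf ab) (negPf ac).
have pU : D1.1 :|: D2.1 :|: D3.1 \proper [set: P].
  by rewrite properEcard subsetT cU cR.
have := L3 _ cR _ _ _ XD1 XD2 XD3 n12 n13 n23 pU cU.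
rewrite (phi_one_sided cardP XD1) (phi_one_sided cardP XD2).
rewrite (phi_one_sided cardP XD3) e1 e2 e3.
case: (one_sided X [set a; b]) => //; case: (one_sided X [set b; c]) => //.
by case: (one_sided X [set a; c]) => //= /(_ erefl erefl).
Qed.

(** * Isomorphisms as colour-preserving bijections *)

Lemma imset_split_sides (A B : finType) (f : A -> B) (b : bool) (T : {set A}) :
  [set f @: S | S : {set A} in split_sides b T] = split_sides b (f @: T).
Proof.
case: b; first by rewrite /= imsetU1 imset_set1 imset0.
rewrite /= -!imset_comp; apply: eq_imset => x /=; exact: imset_set1.
Qed.

Lemma imset_setC (A B : finType) (f : A -> B) (S : {set A}) :
  bijective f -> f @: (~: S) = ~: (f @: S).
Proof.
move=> bij_f; have [g fK gK] := bij_f.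
by apply/setP=> y; rewrite -(gK y) inE !mem_imset ?inE //; apply: bij_inj.
Qed.

(** A bijection preserves emptiness of sides and commutes with complements; conversely, the sides
    can be rebuilt from the colour of each edge. *)
Lemma isomorphic_one_sided (A B : finType) (X : divPointSet A)
    (Y : divPointSet B) : #|A| = 4 ->
  isomorphic X Y <->
  exists2 f : A -> B, bijective f &
    forall d : {set A}, #|d| = 2 -> one_sided Y (f @: d) = one_sided X d.
Proof.
move=> cardA; split=> -[f bij_f Hf]; exists f => //.
  move=> _ /(dividon_exists X)[D XD <-]; rewrite (one_sidedE XD).
  rewrite (one_sidedE (Hf D XD)) /=.
  apply/imsetP/idP=> [[S DS /esym/eqP]|D0].
    by rewrite imset_eq0 => /eqP <-.
  by exists set0; rewrite ?imset0.
move=> D XD; have divD := dividonsP XD; have [cD1 _ _ _] := divD.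
apply: mem_dividons => /=.
- by rewrite -(bij_eq_card bij_f).
- by rewrite card_imset //; apply: bij_inj.
by rewrite Hf // dividon_sidesE // imset_split_sides imset_setC // one_sidedE.
Qed.

Lemma I4_cases (Q : 'I_4 -> Prop) :
  Q p1 -> Q p2 -> Q p3 -> Q p4 -> forall i, Q i.
Proof.
move=> Q1 Q2 Q3 Q4 -[[|[|[|[|m]]]] Hm] //.
- by rewrite (_ : Ordinal Hm = p1) //; apply: val_inj.
- by rewrite (_ : Ordinal Hm = p2) //; apply: val_inj.
- by rewrite (_ : Ordinal Hm = p3) //; apply: val_inj.
- by rewrite (_ : Ordinal Hm = p4) //; apply: val_inj.
Qed.

(** The points [a], [b], [c], [d] are the preimages of [p1] to [p4], so the search for an
    isomorphism becomes a choice of ordering of [P]. *)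
Lemma isomorphic_I4 (P : finType) (X : divPointSet P) (Y : divPointSet 'I_4) :
  #|P| = 4 ->
  isomorphic X Y <->
  exists a b c d, uniq [:: a; b; c; d] /\
    [/\ one_sided X [set a; b] = one_sided Y [set p1; p2],
        one_sided X [set a; c] = one_sided Y [set p1; p3]
      & one_sided X [set a; d] = one_sided Y [set p1; p4]] /\
    [/\ one_sided X [set b; c] = one_sided Y [set p2; p3],
        one_sided X [set b; d] = one_sided Y [set p2; p4]
      & one_sided X [set c; d] = one_sided Y [set p3; p4]].
Proof.
move=> cardP; rewrite isomorphic_one_sided //; split.
  case=> f bij_f Hf; have [g fK gK] := bij_f; have g_inj := can_inj gK.
  exists (g p1), (g p2), (g p3), (g p4); split.
    by rewrite /= !inE !(inj_eq g_inj).
  have E i j : i != j -> one_sided X [set g i; g j] = one_sided Y [set i; j].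
    move=> ij; rewrite -Hf ?imsetU1 ?imset_set1 ?gK //.
    by rewrite cards2 (inj_eq g_inj) ij.
  by rewrite !E.
case=> a [b [c [d [Uabcd [[Eab Eac Ead] [Ebc Ebd Ecd]]]]]].
(* The index is always below 4, so the default [a] of [nth] is never returned. *)
pose g (i : 'I_4) := nth a [:: a; b; c; d] i.
have g_inj : injective g.
  move=> i j /eqP; rewrite nth_uniq // => /eqP; exact: val_inj.
have bij_g : bijective g by apply: inj_card_bij; rewrite // cardP card_ord.
have [f gK fK] := bij_g.
exists f => [|s]; first by exists g.
move=> /eqP/cards2P[x [y [xy ->]]]; rewrite imsetU1 imset_set1.
rewrite -(fK x) -(fK y) !gK.
have: f x != f y by rewrite (can_eq fK).
(* Twelve ordered pairs remain; the decreasing ones are first reversed by [setUC]. *)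
elim/I4_cases: (f x); elim/I4_cases: (f y) => // _; rewrite /g /=.
all: by [| rewrite setUC -?Eab -?Eac -?Ead -?Ebc -?Ebd -?Ecd // setUC].
Qed.

(** * The colourings of the two models and the classification *)

Lemma one_sided_mem (P : finType) (X : divPointSet P) d s b :
  (d, s) \in dividons X -> (set0 \in s) = b -> one_sided X d = b.
Proof. by move=> /one_sidedE /= -> ->. Qed.

(* The sides of the dividon are unknown until its pair of points has been found
in the list. *)
Ltac find_dividon :=
  apply: one_sided_mem;
  [ rewrite /= ?/Conc41_dividons ?/Conv4_dividons !in_setU !in_set1 -!orbA;
    repeat (first [ exact: eqxx | apply/orP; left; exact: eqxx
                  | apply/orP; right ])
  | by rewrite !inE !eq_set4 !inE ].

(** The coloured triangle is [p2 p3 p4], with [p1] isolated. *)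
Lemma one_sided_Conc41 :
  [/\ one_sided Conc41 [set p1; p2] = false,
      one_sided Conc41 [set p1; p3] = false
    & one_sided Conc41 [set p1; p4] = false] /\
  [/\ one_sided Conc41 [set p2; p3],
      one_sided Conc41 [set p2; p4]
    & one_sided Conc41 [set p3; p4]].
Proof. by do 2!split; find_dividon. Qed.

(** The coloured 4-cycle is [p1 p2 p3 p4]; the uncoloured edges are its diagonals. *)
Lemma one_sided_Conv4 :
  [/\ one_sided Conv4 [set p1; p2],
      one_sided Conv4 [set p1; p3] = false
    & one_sided Conv4 [set p1; p4]] /\
  [/\ one_sided Conv4 [set p2; p3],
      one_sided Conv4 [set p2; p4] = false
    & one_sided Conv4 [set p3; p4]].
Proof. by do 2!split; find_dividon. Qed.

Theorem theorem1 (P : finType) (X : divPointSet P) (cardP : #|P| = 4)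
    (L1 : law1 X) (L2 : law2 X) (L3 : law3 X) :
  ~ isomorphic X Conc41 <-> isomorphic X Conv4.
Proof.
rewrite !isomorphic_I4 //.
case: one_sided_Conc41 => -[-> -> ->] [-> -> ->].
case: one_sided_Conv4 => -[-> -> ->] [-> -> ->].
have eC x y : one_sided X [set x; y] = one_sided X [set y; x] by rewrite setUC.
split=> [nConc|[a [b [c [d [Uabcd [[ab _ ad] [bc _ cd]]]]]]]]; last first.
  (* The vertex [x] over [p1] would be isolated, yet every vertex of the coloured cycle [a b c d]
     lies on a coloured edge. *)
  case=> x [y [z [t [Uxyzt [[xy xz xt] _]]]]].
  have x0 u : u != x -> one_sided X [set x; u] = false.
    have := mem_uniq_card Uxyzt (esym cardP) u; rewrite !inE.
    by case/or4P=> /eqP-> //; rewrite eqxx.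
  have dist u v : (u, v) \in [:: (a, b); (b, c); (c, d); (d, a)] -> u != v.
    move: Uabcd; rewrite /= !inE !negb_or.
    case/and4P=> /and3P[nab nac nad] /andP[nbc nbd] ncd _.
    by rewrite !xpair_eqE; case/or4P=> /andP[/eqP-> /eqP->] //; rewrite eq_sym.
  have := mem_uniq_card Uabcd (esym cardP) x; rewrite !inE.
  case/or4P=> /eqP Ex; move: x0; rewrite Ex => x0.
  - by move: ab; rewrite x0 // eq_sym dist // !inE eqxx.
  - by move: bc; rewrite x0 // eq_sym dist // !inE eqxx ?orbT.
  - by move: cd; rewrite x0 // eq_sym dist // !inE eqxx ?orbT.
  - by move: ad; rewrite eC x0 // eq_sym dist // !inE eqxx ?orbT.
have : size (enum P) = 4 by rewrite -cardE.
have := enum_uniq P; case: (enum P) => [|a [|b [|c [|d []]]]] // Uabcd _.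
(* These orderings put each vertex first once, for its star and for the triangle avoiding it, and
   also list the other two 4-cycles. *)
have Ubacd : uniq [:: b; a; c; d] by rewrite (uniq_catCA [:: b] [:: a]).
have Ucabd : uniq [:: c; a; b; d].
  by rewrite (uniq_catCA [:: c] [:: a; b] [:: d]).
have Udabc : uniq [:: d; a; b; c] by rewrite (uniq_catC [:: d]).
have Uacbd : uniq [:: a; c; b; d] by rewrite (uniq_catCA [:: a] [:: c]).
have Uabdc : uniq [:: a; b; d; c].
  by rewrite (uniq_catCA [:: a; b] [:: d] [:: c]).
have := one_sided_triangle cardP L3 (take_uniq 3 Uabcd).
have := one_sided_triangle cardP L3 (take_uniq 3 Uabdc).
have := even_star cardP L1 L2 Uabcd; have := even_star cardP L1 L2 Ubacd.
have := even_star cardP L1 L2 Ucabd; have := even_star cardP L1 L2 Udabc.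
rewrite /= (eC b a) (eC c a) (eC d a) (eC c b) (eC d b) (eC d c).
(* Of the 64 colourings, only three 4-cycles and four triangles survive. *)
case ab: (one_sided X [set a; b]); case ac: (one_sided X [set a; c]);
  case ad: (one_sided X [set a; d]); case bc: (one_sided X [set b; c]);
  case bd: (one_sided X [set b; d]); case cd: (one_sided X [set c; d]) => //=.
all: move=> _ _ _ _ _ _.
(* A 4-cycle is matched with [Conv4] by listing its vertices in cyclic order. *)
all: try by [exists a, b, c, d | exists a, c, b, d; rewrite (eC c b)
  | exists a, b, d, c; rewrite (eC d c)].
(* A coloured triangle would give [Conc41], with the isolated vertex listed first. *)
all: case: nConc.
all: by [exists a, b, c, d | exists b, a, c, d; rewrite (eC b a)
  | exists c, a, b, d; rewrite (eC c a) (eC c b)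
  | exists d, a, b, c; rewrite (eC d a) (eC d b) (eC d c)].
Qed.
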